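(* Let $C$ be a contraction on a Hilbert space $\mathcal{H}_C$ and let $E=\begin{bmatrix} C & 0 \\ B & A \end{bmatrix}$ be a minimal contractive lifting of $C$ on a Hilbert space $\mathcal{H}_E=\mathcal{H}_C\oplus\mathcal{H}_A$. Then for every $a\in\mathbb{D}$ the operator $E_a=(E-aI)(I-\overline{a}E)^{-1}$ is a minimal contractive lifting of $C_a=(C-aI)(I-\overline{a}C)^{-1}$ and satisfies $$E_a=\begin{bmatrix} C_a & 0 \\ S_ABS_C & A_a \end{bmatrix},$$ where $A_a=(A-aI)(I-\overline{a}A)^{-1}$, $S_C=(1-|a|^2)^{1/2}(I-\overline{a}C)^{-1}$ and $S_A=(1-|a|^2)^{1/2}(I-\overline{a}A)^{-1}$.
   Context: $\mathbb{D}$ is the open unit disc. A contraction is a bounded operator of norm at most $1$. A contraction $E$ on $\mathcal{H}_E=\mathcal{H}_C\oplus\mathcal{H}_A$ is a contractive lifting of a contraction $C$ on $\mathcal{H}_C$ if it has the lower triangular form $E=\begin{bmatrix} C & 0 \\ B & A \end{bmatrix}$ with respect to this decomposition; it is minimal if $\mathcal{H}_E=\overline{\mathrm{span}}\{E^nx:x\in\mathcal{H}_C,\ n\ge0\}$. *)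

(* Defs.v *)
From HB Require Import structures.
From mathcomp Require Import all_boot all_order all_algebra.
From mathcomp Require Import complex.
From mathcomp Require Import all_classical all_reals all_analysis.
From mathcomp Require Import ring.
From mathcomp Require Import sesquilinear.

Set Implicit Arguments.
Unset Strict Implicit.
Unset Printing Implicit Defensive.
Import Order.TTheory GRing.Theory Num.Theory.
Import numFieldNormedType.Exports.
Local Open Scope classical_set_scope.
Local Open Scope ring_scope.

(* The inner product is linear in its first argument and conjugate-linear in
   the second. *)
HB.mixin Record CompleteNormedModule_isHilbert (R : realType) (H : Type)
    & CompleteNormedModule R[i] H := {
  inner : {dot H for (@Num.conj R[i])} ;
  inner_normE : forall x : H, inner x x = `|x| ^+ 2
}.

#[short(type="hilbertType")]
HB.structure Definition Hilbert (R : realType) :=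
  {H of CompleteNormedModule R[i] H & CompleteNormedModule_isHilbert R H}.

(* The Hilbert space direct sum, i.e. pairs with the norm
   (`|x|^2 + `|y|^2)^(1/2); the product instances of the library carry the sup
   norm, hence the alias. *)
Definition hsum (R : realType) (H K : hilbertType R) : Type := (H * K)%type.

Lemma ler_sqr_impl (C : numClosedFieldType) (x y : C) :
  0 <= x -> 0 <= y -> x ^+ 2 <= y ^+ 2 -> x <= y.
Proof. by move=> x0 y0; rewrite ler_pXn2r. Qed.

Lemma sqrtC_sqrD_le (C : numClosedFieldType) (p q p' q' : C) :
  0 <= p -> 0 <= q -> 0 <= p' -> 0 <= q' ->
  sqrtC ((p + p') ^+ 2 + (q + q') ^+ 2) <=
  sqrtC (p ^+ 2 + q ^+ 2) + sqrtC (p' ^+ 2 + q' ^+ 2).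
Proof.
move=> p0 q0 p'0 q'0.
have n0 (x y : C) : 0 <= x -> 0 <= y -> 0 <= x ^+ 2 + y ^+ 2.
  by move=> x0 y0; rewrite addr_ge0// exprn_ge0.
have s0 (x y : C) : 0 <= x -> 0 <= y -> 0 <= sqrtC (x ^+ 2 + y ^+ 2).
  by move=> x0 y0; rewrite sqrtC_ge0 n0.
apply: ler_sqr_impl; first by rewrite s0 ?addr_ge0.
  by rewrite addr_ge0 ?s0.
rewrite sqrtCK [leRHS]sqrrD !sqrtCK.
have -> : (p + p') ^+ 2 + (q + q') ^+ 2 =
    p ^+ 2 + q ^+ 2 + (p * p' + q * q') *+ 2 + (p' ^+ 2 + q' ^+ 2).
  by ring.
rewrite lerD2r lerD2l lerMn2r /=.
apply: ler_sqr_impl; first by rewrite addr_ge0 ?mulr_ge0.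
  by rewrite mulr_ge0 ?s0.
rewrite exprMn !sqrtCK -subr_ge0.
have -> : (p ^+ 2 + q ^+ 2) * (p' ^+ 2 + q' ^+ 2) - (p * p' + q * q') ^+ 2 =
    (p * q' - q * p') ^+ 2 by ring.
by rewrite real_exprn_even_ge0// realB ?realM ?ger0_real.
Qed.

Section hsum_instances.
Context (R : realType) (H K : hilbertType R).
Local Notation C := (R[i]).
Local Notation HK := (hsum H K).

HB.instance Definition _ := GRing.Lmodule.copy HK (H * K)%type.

Definition hsum_norm (z : HK) : C := sqrtC (`|z.1| ^+ 2 + `|z.2| ^+ 2).

Lemma ler_hsum_normD (z w : HK) : hsum_norm (z + w) <= hsum_norm z + hsum_norm w.
Proof.
apply: le_trans (sqrtC_sqrD_le (normr_ge0 z.1) (normr_ge0 z.2)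
  (normr_ge0 w.1) (normr_ge0 w.2)).
rewrite ler_sqrtC ?nnegrE ?addr_ge0 ?exprn_ge0 ?addr_ge0//.
by rewrite lerD ?lerXn2r ?nnegrE ?addr_ge0 ?ler_normD.
Qed.

Lemma hsum_normZ (l : C) (z : HK) : hsum_norm (l *: z) = `|l| * hsum_norm z.
Proof.
rewrite /hsum_norm !normrZ !exprMn -mulrDr.
by rewrite sqrtCM ?nnegrE ?exprn_ge0 ?addr_ge0 ?exprn_ge0// sqrCK.
Qed.

Lemma hsum_norm0_eq0 (z : HK) : hsum_norm z = 0 -> z = 0.
Proof.
move/eqP; rewrite sqrtC_eq0 paddr_eq0 ?exprn_ge0// !sqrf_eq0 !normr_eq0.
by case: z => x y /= /andP[/eqP-> /eqP->].
Qed.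

HB.instance Definition _ := Lmodule_isNormed.Build C HK
  ler_hsum_normD hsum_normZ hsum_norm0_eq0.

Lemma hsum_normE (z : HK) : `|z| = sqrtC (`|z.1| ^+ 2 + `|z.2| ^+ 2).
Proof. by []. Qed.

Lemma hsum_norm_fst_le (z : HK) : `|z.1| <= `|z|.
Proof.
rewrite hsum_normE -[leLHS]sqrCK// ler_sqrtC ?nnegrE ?addr_ge0 ?exprn_ge0//.
by rewrite lerDl exprn_ge0.
Qed.

Lemma hsum_norm_snd_le (z : HK) : `|z.2| <= `|z|.
Proof.
rewrite hsum_normE -[leLHS]sqrCK// ler_sqrtC ?nnegrE ?addr_ge0 ?exprn_ge0//.
by rewrite lerDr exprn_ge0.
Qed.

Lemma hsum_norm_le (z : HK) : `|z| <= `|z.1| + `|z.2|.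
Proof.
have := sqrtC_sqrD_le (normr_ge0 z.1) (lexx 0) (lexx 0) (normr_ge0 z.2).
by rewrite !addr0 !add0r !expr0n /= addr0 add0r !sqrCK.
Qed.

Lemma hsum_complete (F : set_system HK) : ProperFilter F -> cauchy F -> cvg F.
Proof.
move=> FF /cauchy_ballP Fc.
have F1c : cauchy ((fst : HK -> H) @ F).
  apply/cauchy_ballP => e e0; rewrite near_map2.
  apply: filterS (Fc e e0) => -[z w].
  rewrite -!ball_normE /=; apply: le_lt_trans.
  exact: (hsum_norm_fst_le (z - w)).
have F2c : cauchy ((snd : HK -> K) @ F).
  apply/cauchy_ballP => e e0; rewrite near_map2.
  apply: filterS (Fc e e0) => -[z w].
  rewrite -!ball_normE /=; apply: le_lt_trans.
  exact: (hsum_norm_snd_le (z - w)).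
have /(@cvg_ex H)[l1 Fl1] : cvg ((fst : HK -> H) @ F) by exact: @cauchy_cvg H _ _ F1c.
have /(@cvg_ex K)[l2 Fl2] : cvg ((snd : HK -> K) @ F) by exact: @cauchy_cvg K _ _ F2c.
apply/cvg_ex; exists ((l1, l2) : HK).
apply/cvgrPdist_lt => e e0.
have e20 : 0 < e / 2 by rewrite divr_gt0.
near=> z.
apply: (le_lt_trans (hsum_norm_le ((l1, l2) - z))); rewrite (splitr e) ltrD//=.
- by near: z; move/cvgrPdist_lt: Fl1 => /(_ _ e20).
- by near: z; move/cvgrPdist_lt: Fl2 => /(_ _ e20).
Unshelve. all: by end_near. Qed.

HB.instance Definition _ := Uniform_isComplete.Build HK hsum_complete.

Definition hsum_inner (z w : HK) : C := inner z.1 w.1 + inner z.2 w.2.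

Let hsum_inner_bilinear :
  bilinear_for ( *%R : GRing.Scale.law C C)
    ((@Num.conj C) \; *%R : GRing.Scale.law C C) hsum_inner.
Proof.
split=> [u c x y|u c x y]; rewrite /hsum_inner /=.
- by rewrite !linearDl !linearZl_LR /= mulrDr addrACA.
- by rewrite !linearDr !linearZr_LR /= addrACA.
Qed.

HB.instance Definition _ := @bilinear_isBilinear.Build C HK HK C
  *%R ((@Num.conj C) \; *%R) hsum_inner hsum_inner_bilinear.

Let hsum_inner_hermitian (z w : HK) :
  hsum_inner z w = (-1) ^+ false * (hsum_inner w z)^*.
Proof.
rewrite expr0 mul1r /hsum_inner rmorphD /=; congr (_ + _).
- by rewrite [LHS]hermitian_subproof expr0 mul1r.
- by rewrite [LHS]hermitian_subproof expr0 mul1r.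
Qed.

HB.instance Definition _ := @isHermitianSesquilinear.Build C HK false
  (@Num.conj C) hsum_inner hsum_inner_hermitian.

Let hsum_innerE (z : HK) : hsum_inner z z = `|z| ^+ 2.
Proof. by rewrite hsum_normE sqrtCK /hsum_inner !inner_normE. Qed.

Let hsum_inner_gt0 (z : HK) : z != 0 -> 0 < hsum_inner z z.
Proof. by move=> z0; rewrite hsum_innerE exprn_gt0 ?normr_gt0. Qed.

HB.instance Definition _ := @isDotProduct.Build C HK hsum_inner hsum_inner_gt0.

HB.instance Definition _ := CompleteNormedModule_isHilbert.Build R HK hsum_innerE.

End hsum_instances.

Section operators.
Context (R : realType).
Local Notation C := (R[i]).
Implicit Types H K : hilbertType R.

Definition bounded_operator H K (T : H -> K) : Prop :=
  linear T /\ exists M : C, forall x, `|T x| <= M * `|x|.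

(* Norms take values in C, whose order is partial; the real part is taken to
   have a supremum in R. *)
Definition opnorm H K (T : H -> K) : R :=
  sup [set complex.Re `|T x| | x in [set x : H | `|x| <= 1]].

Definition contraction_operator H (T : H -> H) : Prop :=
  bounded_operator T /\ opnorm T <= 1.

Definition is_opinv H (T S : H -> H) : Prop :=
  [/\ bounded_operator S, T \o S = id & S \o T = id].

Definition invertible_operator H (T : H -> H) : Prop := exists S, is_opinv T S.

(* Inverse in the algebra of bounded operators; the zero map when T has no
   bounded inverse. *)
Definition opinv H (T : H -> H) : H -> H := xget \0 [set S | is_opinv T S].

Definition linear_span H (S : set H) : set H :=
  [set v | exists (n : nat) (c : 'I_n -> C) (u : 'I_n -> H),
     (forall i, S (u i)) /\ v = \sum_(i < n) c i *: u i].

Definition block_operator H K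
    (T11 : H -> H) (T12 : K -> H) (T21 : H -> K) (T22 : K -> K) :
    hsum H K -> hsum H K :=
  fun z => (T11 z.1 + T12 z.2, T21 z.1 + T22 z.2).

Definition contractive_lifting H K (C : H -> H) (E : hsum H K -> hsum H K) : Prop :=
  [/\ contraction_operator C, contraction_operator E &
      exists (B : H -> K) (A : K -> K),
        [/\ bounded_operator B, bounded_operator A &
            E = block_operator C \0 B A]].

Definition minimal_contractive_lifting H K
    (C : H -> H) (E : hsum H K -> hsum H K) : Prop :=
  contractive_lifting C E /\
  closure (linear_span
    [set v | exists (n : nat) (x : H), v = iter n E (x, 0)]) = setT.

Definition mobius H (a : C) (T : H -> H) : H -> H :=
  (T \- (a \*: idfun)) \o opinv (idfun \- (a^* \*: T)).

Definition scaled_resolvent H (a : C) (T : H -> H) : H -> H :=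
  sqrtC (1 - `|a| ^+ 2) \*: opinv (idfun \- (a^* \*: T)).

End operators.

(* Main.v *)
(* For a contraction T and u = (1 - a^* T)^-1 x, the identity
   |u - a^* Tu|^2 - |Tu - au|^2 = (1 - |a|^2) (|u|^2 - |Tu|^2) shows that T_a is
   again a contraction.  The block form comes from solving
   (1 - a^* E)(u, v) = (x, y) by forward substitution: u = (1 - a^* C)^-1 x and
   v = (1 - a^* A)^-1 (a^* B u + y).  Minimality passes from E to E_a because a
   closed subspace invariant under E_a is invariant under
   E = (E_a + a) (1 + a^* E_a)^-1, the Neumann series of the inverse staying in
   the subspace. *)
Require Import Defs.
From HB Require Import structures.
From mathcomp Require Import all_boot all_order all_algebra.
From mathcomp Require Import complex.
From mathcomp Require Import all_classical all_reals all_analysis.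
From mathcomp Require Import ring sesquilinear.
Import Order.TTheory GRing.Theory Num.Theory.
Import numFieldNormedType.Exports.
Local Open Scope ring_scope.

(** * Contraction mapping principle over complex scalars, inside a closed set *)

Section fixed_point.
Local Open Scope classical_set_scope.

(** The limit of [q ^+ n] is taken for real parts, in [R], and carried back to the partial order of
    [R[i]]. Dividing [e] by [K + 1] covers [K = 0]. *)
Lemma exprn_mul_lt (R : realType) (q K e : R[i]) :
  0 <= q -> q < 1 -> 0 <= K -> 0 < e -> exists N, q ^+ N * K < e.
Proof.
move=> q0 q1 K0 e0.
have K1 : 0 < K + 1 by rewrite ltr_wpDl.
have d0 : 0 < e / (K + 1) by rewrite divr_gt0.
have qE := RRe_real (ger0_real q0); have dE := RRe_real (gtr0_real d0).
have r1 : `|complex.Re q| < 1.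
  by rewrite ger0_norm -?ltcR ?qE// -ler0c qE.
have [N _ /(_ N (leqnn N))] : \forall n \near \oo,
    `|0 - complex.Re q ^+ n| < complex.Re (e / (K + 1)).
  move/cvgrPdist_lt: (cvg_expr r1); apply.
  by rewrite -ltcR dE.
rewrite /= sub0r normrN ger0_norm ?exprn_ge0 -?ler0c ?qE//.
rewrite -ltcR dE rmorphXn /= qE ltr_pdivlMr// => qN; exists N.
by apply: le_lt_trans qN; rewrite ler_wpM2l ?exprn_ge0// lerDl.
Qed.

(* The library's [banach_fixed_point] is about real normed modules only. *)
Lemma complex_banach_fixed_point (R : realType) (V : completeNormedModType R[i])
    (M : set V) (f : V -> V) (q : R[i]) (x0 : V) :
    0 <= q -> q < 1 -> (forall x y, `|f x - f y| <= q * `|x - y|) ->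
    closed M -> M x0 -> (forall x, M x -> M (f x)) ->
  exists2 p, M p & f p = p.
Proof.
move=> q0 q1 fq Mcl Mx0 Mf; pose u n := iter n f x0.
have uM n : M (u n) by elim: n => //= n; exact: Mf.
have q1' : 0 < 1 - q by rewrite subr_gt0.
(* Sum of the geometric series that bounds the distance from [x0] to any iterate; the induction uses
   [K = q * K + |f x0 - x0|]. *)
pose K := `|f x0 - x0| / (1 - q).
have K0 : 0 <= K by rewrite divr_ge0 // ltW.
have uK k : `|u k - x0| <= K.
  elim: k => [|k IH]; first by rewrite subrr normr0.
  apply: le_trans (ler_distD (f x0) _ _) _.
  have -> : K = q * K + `|f x0 - x0|.
    have <- : K * (1 - q) = `|f x0 - x0| by rewrite divfK// gt_eqF.
    by ring.
  by rewrite lerD2r; apply: le_trans (fq _ _) _; rewrite ler_wpM2l.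
have uqn n k : `|u n - u (n + k)%N| <= q ^+ n * K.
  elim: n => [|n IH]; first by rewrite add0n expr0 mul1r distrC uK.
  by apply: le_trans (fq _ _) _; rewrite exprS -mulrA ler_wpM2l.
have /cauchy_cvg/(@cvg_ex V)[l ul] : cauchy (u @ \oo).
  apply/cauchy_exP => e e0; have [N Ne] := @exprn_mul_lt R q K e q0 q1 K0 e0.
  exists (u N); exists N => //= n /subnKC <-.
  by rewrite -ball_normE /=; apply: le_lt_trans Ne; exact: uqn.
exists l.
  by apply: (closed_cvg M Mcl _ l ul); apply: nearW.
apply/eqP; rewrite -subr_eq0 -normr_eq0; apply/negP => /negP fl.
have {fl}fl : 0 < `|f l - l| by rewrite lt_def fl normr_ge0.
have fl2 : 0 < `|f l - l| / 2 by rewrite divr_gt0.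
move/cvgrPdist_lt: ul => /(_ _ fl2)[N _ uN].
have : `|f l - l| < `|f l - l|.
  rewrite [ltRHS]splitr.
  apply: le_lt_trans (ler_distD (u N.+1) _ _) _.
  rewrite ltrD//; last by rewrite distrC; apply: uN => /=.
  apply: le_lt_trans (fq _ _) _.
  by apply: le_lt_trans (uN N (leqnn N)); rewrite ler_piMl// ltW.
by rewrite ltxx.
Qed.

End fixed_point.

Lemma closure_normP (K : numFieldType) (V : normedModType K) (S : set V) (v : V) :
  closure S v <-> forall e, 0 < e -> exists2 w, S w & `|v - w| < e.
Proof.
split=> [Sv e e0|Sv B].
  by have [w [Sw]] := Sv _ (nbhsx_ballx v e e0); rewrite -ball_normE; exists w.
move=> /nbhs_ballP[e /= e0 eB]; have [w Sw vw] := Sv e e0.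
by exists w; split=> //; apply: eB; rewrite -ball_normE.
Qed.

(** * Bounded operators and contractions *)

Section operators.
Context {R : realType}.
Implicit Types H K L : hilbertType R.

(** The modulus of the given constant works: [M * |x|] dominates a norm, so it is nonnegative and
    equals its own modulus. *)
Lemma bounded_operatorP {H K} (T : H -> K) :
  bounded_operator T ->
  exists2 M : R[i], 0 <= M & forall x, `|T x| <= M * `|x|.
Proof.
move=> [_ [M TM]]; exists `|M| => // x.
have Mx0 : 0 <= M * `|x| by apply: le_trans (TM x).
by rewrite -[X in _ * X]normr_id -normrM ger0_norm.
Qed.

Lemma bounded_operator_comp {H K L} (S : K -> L) (T : H -> K) :
  bounded_operator S -> bounded_operator T -> bounded_operator (S \o T).
Proof.
move=> Sb Tb; have [M M0 SM] := bounded_operatorP _ Sb.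
have [N N0 TN] := bounded_operatorP _ Tb; case: Sb Tb => [Sl _] [Tl _].
split; first by move=> c u v /=; rewrite Tl Sl.
exists (M * N) => x /=; apply: le_trans (SM _) _.
by rewrite -mulrA ler_wpM2l.
Qed.

Lemma bounded_operator_scale {H K} (c : R[i]) (T : H -> K) :
  bounded_operator T -> bounded_operator (c \*: T).
Proof.
move=> [Tl [M TM]]; split=> [d u v /=|].
  by rewrite Tl scalerDr !scalerA mulrC.
by exists (`|c| * M) => x /=; rewrite normrZ -mulrA ler_wpM2l.
Qed.

(** Trades the supremum in [opnorm] for a pointwise bound, by rescaling to unit vectors. *)
Lemma contraction_operatorP {H} (T : H -> H) :
  contraction_operator T <-> linear T /\ forall x, `|T x| <= `|x|.
Proof.
pose U := [set complex.Re `|T x| | x in [set x : H | `|x| <= 1]]%classic.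
have ReC (V : normedModType R[i]) (x : V) : (complex.Re `|x|)%:C%C = `|x|.
  by rewrite RRe_real ?normr_real.
split=> [[Tb T1]|[Tl T1]]; last first.
  split; first by split=> //; exists 1 => x; rewrite mul1r.
  apply: ge_sup; first by exists (complex.Re `|T 0|), 0 => //=; rewrite normr0.
  by move=> _ [x /= x1 <-]; rewrite -lecR ReC; apply: le_trans (T1 x) x1.
have [M M0 TM] := bounded_operatorP _ Tb; have [Tl _] := Tb.
have TZ c x : T (c *: x) = c *: T x by exact: (GRing.scalable_linear Tl).
split=> // x; have [->|x0] := eqVneq x 0.
  by rewrite -[in T _](scale0r 0) TZ scale0r normr0.
have nx : 0 < `|x| by rewrite normr_gt0.
pose y := `|x|^-1 *: x.
have y1 : `|y| = 1 by rewrite normrZ normfV normr_id mulVf ?gt_eqF.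
have xE : x = `|x| *: y by rewrite scalerA mulfV ?scale1r ?gt_eqF.
have Ty : `|T y| <= 1.
  rewrite -ReC (_ : 1 = 1%:C%C)// lecR; apply: le_trans T1.
  (* The supremum is an upper bound only because boundedness of [T] bounds the set of values. *)
  apply: ub_le_sup; last by exists y => //=; rewrite y1.
  exists (complex.Re M) => _ [z /= z1 <-]; rewrite -lecR ReC RRe_real ?ger0_real//.
  by apply: le_trans (TM z) _; rewrite ler_piMr.
by rewrite {1}xE TZ normrZ normr_id ler_piMr.
Qed.

Lemma opinvP {H} (T : H -> H) : invertible_operator T -> is_opinv T (opinv T).
Proof. by case=> S TS; apply: (xgetPex _ (ex_intro _ S TS)). Qed.

End operators.

(** * The equation [x - b *: T x = y] for a contraction [T] *)

Lemma sub_scale_ge {R : realType} {V : normedModType R[i]} (T : V -> V) (b : R[i]) :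
  (forall x, `|T x| <= `|x|) ->
  forall x, (1 - `|b|) * `|x| <= `|x - b *: T x|.
Proof.
move=> T1 x; apply: le_trans (lerB_dist _ _).
by rewrite mulrBl mul1r lerD2l lerN2 normrZ ler_wpM2l.
Qed.

(** The solution is the fixed point of [x |-> b *: T x + y], which shrinks distances by [|b|] and
    preserves [M]. Taking [M] to be the whole space gives resolvents; taking a closed span keeps the
    solution inside it. *)
Lemma neumann_solve {R : realType} {V : completeNormedModType R[i]}
    (M : set V) (T : V -> V) (b : R[i]) (y : V) :
    linear T -> (forall x, `|T x| <= `|x|) -> `|b| < 1 ->
    closed M -> (forall c u v, M u -> M v -> M (c *: u + v)) ->
    (forall x, M x -> M (T x)) -> M y ->
  exists2 x, M x & x - b *: T x = y.
Proof.
move=> Tl T1 b1 Mcl Mlin MT My.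
have TB u v : T (u - v) = T u - T v by exact: (GRing.zmod_morphism_linear Tl).
have [||x Mx xE] := @complex_banach_fixed_point R V M (fun x => b *: T x + y)
  `|b| y (normr_ge0 b) b1 _ Mcl My.
- move=> u v; rewrite opprD addrACA subrr addr0 -scalerBr -TB normrZ.
  by rewrite ler_wpM2l.
- by move=> u Mu; apply: Mlin => //; apply: MT.
- by exists x => //; rewrite -{1}xE addrAC subrr add0r.
Qed.

(** Both squares on the left expand to the same cross terms, which cancel. *)
Lemma norm_sub_scale {R : realType} {H : hilbertType R} (a : R[i]) (u v : H) :
  `|u - a^* *: v| ^+ 2 - `|v - a *: u| ^+ 2 =
  (1 - `|a| ^+ 2) * (`|u| ^+ 2 - `|v| ^+ 2).
Proof.
rewrite -!inner_normE !linearBl !linearBr /= !linearZl_LR !linearZr_LR /=.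
by rewrite conjCK normCK /GRing.scale /=; ring.
Qed.

(** * Resolvent and Möbius transform of a contraction *)

Section mobius_transform.
Context {R : realType} {H : hilbertType R} {a : R[i]} {T : H -> H}.
Hypotheses (a1 : `|a| < 1) (Tl : linear T) (T1 : forall x, `|T x| <= `|x|).
Let S := opinv (idfun \- (a^* \*: T)).

Let b1 : `|a^*| < 1. Proof. by rewrite norm_conjC. Qed.
Let TZ c x : T (c *: x) = c *: T x.
Proof. exact: (GRing.scalable_linear Tl). Qed.
Let TB x y : T (x - y) = T x - T y.
Proof. exact: (GRing.zmod_morphism_linear Tl). Qed.

Lemma resolvent_inj x y : x - a^* *: T x = y - a^* *: T y -> x = y.
Proof.
move=> xy; apply/eqP; rewrite -subr_eq0 -normr_le0.
have := sub_scale_ge T a^* T1 (x - y).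
have -> : x - y - a^* *: T (x - y) = 0.
  rewrite -[RHS](subrr (x - a^* *: T x)) {2}xy TB scalerBr.
  by rewrite !opprB addrACA [RHS]addrACA [- y + _]addrC.
by rewrite normr0 pmulr_rle0// subr_gt0.
Qed.

(** Solvability gives a right inverse [U] by choice. Injectivity makes it a left inverse and proves
    it linear; the lower bound [sub_scale_ge] makes it bounded. *)
Lemma resolvent_invertible : invertible_operator (idfun \- (a^* \*: T)).
Proof.
have /choice[U UE] (y : H) : exists x, x - a^* *: T x = y.
  have [x _ xE] := @neumann_solve R H setT T a^* y Tl T1 b1 closedT
    (fun _ _ _ _ _ => I) (fun _ _ => I) I.
  by exists x.
exists U; split; last 2 first.
- by apply/funext => y; exact: UE.
- by apply/funext => x; apply: resolvent_inj; rewrite UE.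
split.
  move=> c u v; apply: resolvent_inj; rewrite UE Tl scalerDr opprD addrACA.
  by rewrite UE [_ *: (c *: _)]scalerA mulrC -scalerA -scalerBr UE.
exists (1 - `|a^*|)^-1 => y.
rewrite ler_pdivlMl ?subr_gt0//.
by rewrite -{2}(UE y); exact: sub_scale_ge.
Qed.

Lemma resolventK x : S x - a^* *: T (S x) = x.
Proof. by have [_ /(congr1 (@^~ x))] := opinvP _ resolvent_invertible. Qed.

(** Evaluating a resolvent thus amounts to exhibiting one preimage, which is how the block operator
    is handled. *)
Lemma resolventE u x : u - a^* *: T u = x -> S x = u.
Proof. by move=> <-; apply: resolvent_inj; rewrite resolventK. Qed.

Lemma mobiusE x : mobius a T x = T (S x) - a *: S x.
Proof. by []. Qed.

Lemma resolvent_bounded : bounded_operator S.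
Proof. by have [] := opinvP _ resolvent_invertible. Qed.

Lemma scaled_resolvent_bounded : bounded_operator (scaled_resolvent a T).
Proof. exact: bounded_operator_scale resolvent_bounded. Qed.

Lemma mobius_linear : linear (mobius a T).
Proof.
move=> c u v; rewrite !mobiusE; have [Sl _] := resolvent_bounded.
rewrite Sl Tl scalerDr opprD addrACA; congr (_ + _).
by rewrite scalerA mulrC -scalerA scalerBr.
Qed.

Lemma mobius_norm_le x : `|mobius a T x| <= `|x|.
Proof.
rewrite -(@ler_pXn2r _ 2) ?nnegrE// -{2}(resolventK x) mobiusE -subr_ge0.
rewrite norm_sub_scale mulr_ge0 ?subr_ge0 ?ler_pXn2r ?nnegrE//.
by rewrite exprn_ile1// ltW.
Qed.

Lemma mobius_contraction : contraction_operator (mobius a T).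
Proof.
by apply/contraction_operatorP; split;
  [exact: mobius_linear | exact: mobius_norm_le].
Qed.

(* That is, [T = (T_a + a) (1 + a^* T_a)^-1]. *)
Lemma mobius_inverse w :
  T (w + a^* *: mobius a T w) = mobius a T w + a *: w.
Proof.
(* With [u = S w], the argument of [T] on the left is [(1 - |a|^2) u], and the right side is
   [(1 - |a|^2) T u]. *)
have wE := resolventK w; rewrite mobiusE; set u := S w in wE *.
rewrite -wE scalerBr addrA subrK scalerBr addrA subrK TB !TZ !scalerA.
by rewrite mulrC.
Qed.

End mobius_transform.

(** * Closed linear spans and cyclicity *)

Section closed_linear_span.
Context {R : realType} {H : hilbertType R}.
Implicit Types (S M : set H) (T : H -> H).

Lemma linear_span_sub S M :
  M 0 -> (forall c u v, M u -> M v -> M (c *: u + v)) -> (S `<=` M)%classic ->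
  (linear_span S `<=` M)%classic.
Proof.
move=> M0 Mlin SM _ [n [c [u [Su ->]]]].
elim/big_ind: _ => // [x y Mx My|i _].
  by rewrite -[x]scale1r; exact: Mlin.
by rewrite -[_ *: _]addr0; apply: Mlin => //; apply: SM.
Qed.

Lemma sub_linear_span S : (S `<=` linear_span S)%classic.
Proof.
move=> u Su; exists 1%N, (fun=> 1), (fun=> u); split=> //.
by rewrite big_ord1 scale1r.
Qed.

Lemma linear_span_linear S c u v :
  linear_span S u -> linear_span S v -> linear_span S (c *: u + v).
Proof.
move=> [n [cu [eu [Su ->]]]] [m [cv [ev [Sv ->]]]].
exists (n + m)%N,
  (fun i => match fintype.split i with inl j => c * cu j | inr j => cv j end),
  (fun i => match fintype.split i with inl j => eu j | inr j => ev j end).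
split=> [i|]; first by case: fintype.split.
rewrite big_split_ord scaler_sumr; congr (_ + _); apply: eq_bigr => i _.
  by rewrite -[lshift m i]/(unsplit (inl i)) unsplitK scalerA.
by rewrite -[rshift n i]/(unsplit (inr i)) unsplitK.
Qed.

Lemma linear_span0 S : linear_span S 0.
Proof.
exists 0%N, (fun=> 0), (fun=> 0); split; first by case.
by rewrite big_ord0.
Qed.

Lemma closure_linear M c u v :
  (forall c u v, M u -> M v -> M (c *: u + v)) ->
  closure M u -> closure M v -> closure M (c *: u + v).
Proof.
move=> Mlin /closure_normP Mu /closure_normP Mv; apply/closure_normP => e e0.
have e2 : 0 < e / 2 by rewrite divr_gt0.
(* The added 1 keeps the divisor positive when [c = 0]. *)
have c1 : 0 < `|c| + 1 by rewrite ltr_wpDl.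
have [x Mx ux] := Mu _ (divr_gt0 e2 c1); have [y My vy] := Mv _ e2.
exists (c *: x + y); first exact: Mlin.
rewrite opprD addrACA -scalerBr (splitr e).
apply: le_lt_trans (ler_normD _ _) _; rewrite ltrD// normrZ.
move: ux; rewrite ltr_pdivlMr// mulrC; apply: le_lt_trans.
by rewrite ler_wpM2r// lerDl.
Qed.

(** If [y] approximates [x], then [T y] approximates [T x] at least as well. It stays in the span
    because the preimage of the span under [T] is a subspace containing [S]. *)
Lemma closure_linear_span_invariant S T :
  linear T -> (forall x, `|T x| <= `|x|) -> (forall x, S x -> S (T x)) ->
  forall x, closure (linear_span S) x -> closure (linear_span S) (T x).
Proof.
move=> Tl T1 ST x /closure_normP Sx; apply/closure_normP => e /Sx[y Sy xy].
have TB u v : T (u - v) = T u - T v by exact: (GRing.zmod_morphism_linear Tl).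
exists (T y); last by rewrite -TB; apply: le_lt_trans xy.
apply: (linear_span_sub S (fun y => linear_span S (T y)) _ _ _ _ Sy).
- by rewrite -(subrr 0) TB subrr; exact: linear_span0.
- by move=> c u v Su Sv; rewrite Tl; exact: linear_span_linear.
- by move=> z /ST/sub_linear_span.
Qed.

(* The closed span M of the orbits of T_a is invariant under T: for z in M, the
   equation (1 + a^* T_a) w = z is solvable within M, and then
   T z = T_a w + a w lies in M. *)
Lemma mobius_cyclic (I : Type) (f : I -> H) (a : R[i]) T :
    `|a| < 1 -> linear T -> (forall x, `|T x| <= `|x|) ->
    closure (linear_span [set v | exists n i, v = iter n T (f i)]) = setT ->
  closure (linear_span [set v | exists n i, v = iter n (mobius a T) (f i)]) =
    setT.
Proof.
move=> a1 Tl T1 cycT.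
set S := [set v | exists n i, v = iter n (mobius a T) (f i)]%classic.
set M := closure (linear_span S).
have Mcl : closed M by exact: closed_closure.
have Mlin c u v : M u -> M v -> M (c *: u + v).
  by apply: closure_linear => *; exact: linear_span_linear.
have Ml := mobius_linear a1 Tl T1; have M1 := mobius_norm_le a1 Tl T1.
have Minv : forall x, M x -> M (mobius a T x).
  apply: closure_linear_span_invariant => // _ [n [i ->]].
  by exists n.+1, i.
have MT z : M z -> M (T z).
  (* The coefficient [- a^*] turns [neumann_solve] into the equation with a plus sign. *)
  move=> Mz; have b1 : `|- a^*| < 1 by rewrite normrN norm_conjC.
  have [w Mw wz] := neumann_solve _ _ _ _ Ml M1 b1 Mcl Mlin Minv Mz.
  move: wz; rewrite scaleNr opprK => <-.
  by rewrite mobius_inverse// addrC; apply: Mlin => //; exact: Minv.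
apply/seteqP; split=> // z _.
have : closure (linear_span [set v | exists n i, v = iter n T (f i)]) z.
  by rewrite cycT.
rewrite (closure_id M).1//; apply: closure_subset.
apply: linear_span_sub => //.
  by apply: subset_closure; exact: linear_span0.
move=> _ [n [i ->]]; elim: n => [|n IH]; last exact: MT.
by apply/subset_closure/sub_linear_span; exists 0%N, i.
Qed.

End closed_linear_span.


(** * Block form and minimality of the transformed lifting *)

Theorem theorem5p1 (R : realType) (HC HA : hilbertType R)
    (C : HC -> HC) (B : HC -> HA) (A : HA -> HA)
    (E : hsum HC HA -> hsum HC HA)
    (C_contraction : contraction_operator C)
    (B_bounded : bounded_operator B) (A_bounded : bounded_operator A)
    (E_block : E = block_operator C \0 B A)
    (E_lifting : minimal_contractive_lifting C E) :
  forall a : R[i], `|a| < 1 ->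
    [/\ invertible_operator (idfun \- (a^* \*: C)),
        invertible_operator (idfun \- (a^* \*: A)) &
        invertible_operator (idfun \- (a^* \*: E))] /\
    minimal_contractive_lifting (mobius a C) (mobius a E) /\
    mobius a E =
      block_operator (mobius a C) \0
        (scaled_resolvent a A \o B \o scaled_resolvent a C) (mobius a A).
Proof.
move=> a a1; have [[_ /contraction_operatorP[El E1] _] E_cyclic] := E_lifting.
have [Cl C1] := (contraction_operatorP C).1 C_contraction.
have [Al _] := A_bounded; have [Bl _] := B_bounded.
(* [A] is the restriction of [E] to the second summand, hence a contraction, so the resolvent
   results apply to it. *)
have A1 y : `|A y| <= `|y|.
  have := le_trans (hsum_norm_snd_le (E (0, y))) (le_trans (E1 _) (hsum_norm_le _)).
  have B0 : B 0 = 0 by have := GRing.zmod_morphism_linear Bl 0 0; rewrite !subrr.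
  by rewrite E_block /= B0 normr0 !add0r.
have BZ c x : B (c *: x) = c *: B x by exact: (GRing.scalable_linear Bl).
have blockE : mobius a E =
    block_operator (mobius a C) \0
      (scaled_resolvent a A \o B \o scaled_resolvent a C) (mobius a A).
  apply/funext => -[x y]; rewrite /block_operator /=.
  set s := sqrtC (1 - `|a| ^+ 2).
  have s2 : s * s = 1 - a * a^* by rewrite -expr2 sqrtCK normCK.
  set RA := opinv (idfun \- (a^* \*: A)).
  set RC := opinv (idfun \- (a^* \*: C)).
  have RAZ c z : RA (c *: z) = c *: RA z.
    exact: (GRing.scalable_linear (proj1 (resolvent_bounded a1 Al A1))).
  (* The pair [(u, v)] is the preimage of [(x, y)]; [v] is split by linearity so that [w] isolates
     the contribution of [B]. *)
  pose u := RC x; pose w := RA (B u); pose v := a^* *: w + RA y.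
  have uE : u - a^* *: C u = x by exact: resolventK.
  have wE : w - a^* *: A w = B u by exact: resolventK.
  have yE : RA y - a^* *: A (RA y) = y by exact: resolventK.
  have vE : v - a^* *: A v = a^* *: B u + y.
    by rewrite /v Al -wE -[in RHS]yE scalerDr scalerBr opprD addrACA.
  rewrite mobiusE (@resolventE _ _ _ _ a1 El E1 (u, v)); last first.
    rewrite E_block /block_operator /=; congr (_, _) => /=.
      by rewrite addr0.
    by rewrite scalerDr opprD addrA addrAC vE addrAC subrr add0r.
  rewrite E_block /block_operator /=; congr (_, _) => /=.
    by rewrite !addr0.
  (* The scalar factors of the two scaled resolvents come out by linearity and multiply to
     [1 - |a|^2]. *)
  have -> : scaled_resolvent a A (B (scaled_resolvent a C x)) = (1 - a * a^*) *: w.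
    by rewrite -s2 -scalerA -RAZ -BZ.
  rewrite mobiusE -/RA.
  (* Once [B u] is replaced by [w - a^* A w], the terms in [A w] cancel, leaving [(1 - |a|^2) w]
     plus the transform of [A] at [y]. *)
  rewrite /v Al -wE scalerDr opprD addrA.
  rewrite !addrA; congr (_ - _); rewrite [LHS]addrAC; congr (_ + _).
  by rewrite scalerA scalerBl scale1r subrK.
have lift : contraction_operator (mobius a E) by exact: mobius_contraction.
split; first by split; exact: resolvent_invertible.
split=> //; split; last first.
  exact: (mobius_cyclic _ (fun x => (x, 0) : hsum HC HA)).
split=> //; first exact: mobius_contraction.
exists (scaled_resolvent a A \o B \o scaled_resolvent a C), (mobius a A).
split=> //; last by have [] := mobius_contraction a1 Al A1.
apply: bounded_operator_comp; last exact: scaled_resolvent_bounded.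
by apply: bounded_operator_comp => //; exact: scaled_resolvent_bounded.
Qed.
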